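(* TwoCovering $\le_{ql}$ Bipartite3DominatingSet, and TwoCovering $\le_{ql}$ BipartiteSubset2DominatingSet.
   Context: Quasilinear reductions: for an instance $I$ let $s(I)$ be its size. A quasilinear Karp reduction from problem $\mathcal P$ to problem $\mathcal Q$ (written $\mathcal P\le_{ql}\mathcal Q$) is a function $\Phi$ from instances of $\mathcal P$ to instances of $\mathcal Q$ such that for every instance $I$ of $\mathcal P$: $\Phi(I)$ can be computed in time $\tilde O(s(I))$ (that is, $O(s(I)\log^j s(I))$ for a fixed $j$), and $I$ and $\Phi(I)$ have the same output; if the outputs are not of the same type, one additionally requires a linear-time computable function transforming the output of $\Phi(I)$ into the output of $I$. TwoCovering: input is a finite set $X$ and a collection $\mathcal C$ of subsets of $X$ (of arbitrary size); output True if there are $C,C'\in\mathcal C$ with $X=C\cup C'$, False otherwise. For a vertex $v$, $N(v)$ denotes its neighbourhood. Bipartite3DominatingSet: input is a bipartite graph $G=(V,E)$; output a triple of vertices $v,w,x$ with $V=N(v)\cup N(w)\cup N(x)\cup\{v,w,x\}$, if one exists. BipartiteSubset2DominatingSet: input is a graph $G=(V,E)$ and a subset $V'\subseteq V$; output a pair of vertices $v,w$ with $V'\subseteq N(v)\cup N(w)\cup\{v,w\}$, if one exists. *)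

(* Defs.v *)
From mathcomp Require Import all_boot.

Set Implicit Arguments.
Unset Strict Implicit.
Unset Printing Implicit Defensive.

(******************************************************************************)
(* Model of computation: the random access machine of Cook-Reckhow and        *)
(* Aho-Hopcroft-Ullman, with a read-only input tape and a write-only output   *)
(* tape of natural numbers, under the logarithmic cost criterion.             *)
(******************************************************************************)

(* Bit length, with bitlen 0 = 1. *)
Definition bitlen (n : nat) : nat := (trunc_log 2 n).+1.

(* r_i is register i; subtraction is truncated.                               *)
(*   Const i c    r_i <- c               Add i j k    r_i <- r_j + r_k        *)
(*   Sub i j k    r_i <- r_j - r_k       Fetch i j    r_i <- r_(r_j)          *)
(*   Store i j    r_(r_i) <- r_j         Jzero i l    if r_i = 0 then goto l  *)
(*   Read i       r_i <- next input number (0 if the input is exhausted)      *)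
(*   Write i      append r_i to the output                                    *)
Inductive instr :=
  | Const of nat & nat
  | Add of nat & nat & nat
  | Sub of nat & nat & nat
  | Fetch of nat & nat
  | Store of nat & nat
  | Jzero of nat & nat
  | Read of nat
  | Write of nat.

Definition program := seq instr.

Record state := State {
  pc : nat;
  reg : nat -> nat;
  inp : seq nat;
  outp : seq nat
}.

Definition upd (r : nat -> nat) (i v : nat) : nat -> nat :=
  fun j => if j == i then v else r j.

Definition step_instr (a : instr) (s : state) : state :=
  let: State l r x y := s in
  match a with
  | Const i c   => State l.+1 (upd r i c) x y
  | Add i j k   => State l.+1 (upd r i (r j + r k)) x y
  | Sub i j k   => State l.+1 (upd r i (r j - r k)) x y
  | Fetch i j   => State l.+1 (upd r i (r (r j))) x y
  | Store i j   => State l.+1 (upd r (r i) (r j)) x y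
  | Jzero i l'  => State (if r i == 0 then l' else l.+1) r x y
  | Read i      => State l.+1 (upd r i (head 0 x)) (behead x) y
  | Write i     => State l.+1 r x (rcons y (r i))
  end.

(* Logarithmic cost: the bit lengths of all register addresses accessed and   *)
(* of all numbers read by the instruction.                                    *)
Definition cost_instr (a : instr) (s : state) : nat :=
  let r := reg s in
  match a with
  | Const i c   => bitlen i + bitlen c
  | Add i j k   => bitlen i + bitlen j + bitlen k + bitlen (r j) + bitlen (r k)
  | Sub i j k   => bitlen i + bitlen j + bitlen k + bitlen (r j) + bitlen (r k)
  | Fetch i j   => bitlen i + bitlen j + bitlen (r j) + bitlen (r (r j))
  | Store i j   => bitlen i + bitlen j + bitlen (r i) + bitlen (r j)
  | Jzero i _   => bitlen i + bitlen (r i)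
  | Read i      => bitlen i + bitlen (head 0 (inp s))
  | Write i     => bitlen i + bitlen (r i)
  end.

(* The machine halts when the program counter leaves the program. *)
Inductive runs (p : program) : state -> nat -> state -> Prop :=
  | Runs_halt s : size p <= pc s -> runs p s 0 s
  | Runs_step s t s' (a := nth (Const 0 0) p (pc s)) :
      pc s < size p -> runs p (step_instr a s) t s' ->
      runs p s (cost_instr a s + t) s'.

Definition computes (p : program) (x : seq nat) (t : nat) (y : seq nat) : Prop :=
  exists2 s, runs p (State 0 (fun=> 0) x [::]) t s & outp s = y.

(* f is computable in time O(F(sz a)) on argument a. *)
Definition computable_in_O (A B : Type) (encA : A -> seq nat)
    (encB : B -> seq nat) (sz : A -> nat) (F : nat -> nat) (f : A -> B) : Prop :=
  exists p : program, exists c N : nat, forall a : A,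
    exists2 t, computes p (encA a) t (encB (f a)) &
               N <= sz a -> t <= c * F (sz a).

(******************************************************************************)
(* Problems and quasilinear Karp reductions                                   *)
(******************************************************************************)

(* A problem is a relation: a search problem may have several correct outputs *)
(* on the same instance.                                                      *)
Record problem := Problem {
  inst : Type;
  out : Type;
  isize : inst -> nat;
  enc_inst : inst -> seq nat;
  enc_out : out -> seq nat;
  correct : inst -> out -> Prop
}.

Definition quasilinear_time (P Q : problem) (Phi : inst P -> inst Q) : Prop :=
  exists j : nat,
    computable_in_O (@enc_inst P) (@enc_inst Q) (@isize P)
      (fun s => s * trunc_log 2 s ^ j) Phi.

Definition linear_time (P Q : problem) (g : out P -> out Q) : Prop :=
  computable_in_O (@enc_out P) (@enc_out Q)
    (fun o => \sum_(k <- enc_out o) bitlen k) id g.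

Definition ql_reducible (P Q : problem) : Prop :=
  exists Phi : inst P -> inst Q,
  [/\ quasilinear_time Phi,
      forall (e : out Q = out P) (I : inst P) (o : out Q),
        correct (Phi I) o <-> correct I (eq_rect (out Q) id o (out P) e)
    & out Q <> out P ->
      exists2 g : out Q -> out P, linear_time g &
        forall (I : inst P) (o : out Q), correct (Phi I) o -> correct I (g o)].

(******************************************************************************)
(* TwoCovering                                                                *)
(******************************************************************************)

(* The ground set X is {0, ..., ground - 1}. *)
Record set_system := SetSystem {
  ground : nat;
  coll : seq {set 'I_ground}
}.

Definition enc_set (n : nat) (A : {set 'I_n}) : seq nat :=
  #|A| :: [seq val x | x <- enum A].

Definition set_system_size (S : set_system) : nat :=
  ground S + size (coll S) + \sum_(C <- coll S) #|C|.

Definition enc_set_system (S : set_system) : seq nat :=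
  [:: ground S, size (coll S) & flatten [seq enc_set C | C <- coll S]].

Definition enc_bool (b : bool) : seq nat := [:: nat_of_bool b].

Definition two_covering_correct (S : set_system) (b : bool) : Prop :=
  b <-> exists C C' : {set 'I_(ground S)},
          [/\ C \in coll S, C' \in coll S & [set: 'I_(ground S)] = C :|: C'].

Definition TwoCovering : problem :=
  Problem set_system_size enc_set_system enc_bool two_covering_correct.

(******************************************************************************)
(* Graphs                                                                     *)
(******************************************************************************)

(* Finite simple undirected graphs given by their edge list; each edge is     *)
(* listed once, smaller endpoint first.                                       *)
Record graph := Graph {
  order : nat;
  edges : seq ('I_order * 'I_order);
  edges_lt : all (fun e : 'I_order * 'I_order => e.1 < e.2) edges;
  edges_uniq : uniq edges
}.

Definition adj (G : graph) (u v : 'I_(order G)) : bool :=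
  ((u, v) \in edges G) || ((v, u) \in edges G).

Definition nbhd (G : graph) (v : 'I_(order G)) : {set 'I_(order G)} :=
  [set u | adj v u].

Definition bipartite (G : graph) : Prop :=
  exists side : 'I_(order G) -> bool,
    forall u v : 'I_(order G), adj u v -> side u != side v.

Definition graph_size (G : graph) : nat := order G + size (edges G).

Definition enc_graph (G : graph) : seq nat :=
  [:: order G, size (edges G)
    & flatten [seq [:: val e.1; val e.2] | e <- edges G]].

(******************************************************************************)
(* Bipartite3DominatingSet                                                    *)
(******************************************************************************)

Record bipartite_graph := BipartiteGraph {
  bgraph :> graph;
  bgraphP : bipartite bgraph
}.

Definition enc_triple (o : option (nat * nat * nat)) : seq nat :=
  if o is Some (v, w, x) then [:: 1; v; w; x] else [:: 0].

Definition dominates3 (G : graph) (v w x : 'I_(order G)) : Prop :=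
  [set: 'I_(order G)] = nbhd v :|: nbhd w :|: nbhd x :|: [set v; w; x].

Definition dominating3_correct (G : bipartite_graph)
    (o : option (nat * nat * nat)) : Prop :=
  if o is Some t then
    exists v w x : 'I_(order G), t = (val v, val w, val x) /\ dominates3 v w x
  else ~ exists v w x : 'I_(order G), dominates3 v w x.

Definition Bipartite3DominatingSet : problem :=
  @Problem bipartite_graph (option (nat * nat * nat))
    graph_size enc_graph enc_triple dominating3_correct.

(******************************************************************************)
(* BipartiteSubset2DominatingSet                                              *)
(******************************************************************************)

Record subset_graph := SubsetGraph {
  sgraph :> bipartite_graph;
  subset : {set 'I_(order sgraph)}
}.

Definition subset_graph_size (H : subset_graph) : nat :=
  graph_size H + #|subset H|.

Definition enc_subset_graph (H : subset_graph) : seq nat :=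
  enc_graph H ++ enc_set (subset H).

Definition enc_pair (o : option (nat * nat)) : seq nat :=
  if o is Some (v, w) then [:: 1; v; w] else [:: 0].

Definition dominates2 (G : graph) (A : {set 'I_(order G)})
    (v w : 'I_(order G)) : Prop :=
  A \subset nbhd v :|: nbhd w :|: [set v; w].

Definition subset2_correct (H : subset_graph) (o : option (nat * nat)) : Prop :=
  if o is Some t then
    exists v w : 'I_(order H),
      t = (val v, val w) /\ dominates2 (subset H) v w
  else ~ exists v w : 'I_(order H), dominates2 (subset H) v w.

Definition BipartiteSubset2DominatingSet : problem :=
  Problem subset_graph_size enc_subset_graph enc_pair subset2_correct.

(* Main.v *)
(* Give every x in X three twin copies, add a dummy element (also in three    *)
(* copies) that belongs to every set, and join the copies of x to the sets    *)
(* containing x. Two vertices that dominate all copies miss, for each x, one  *)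
(* of its copies as a member, hence one of them is a set containing x: the    *)
(* sets among the two vertices cover X, and the dummy makes sure that there   *)
(* is at least one. This gives the reduction to the subset problem. A hub     *)
(* joined to all sets and to four pendant vertices must belong to every       *)
(* dominating triple and dominates no copy, so the same graph also gives the  *)
(* reduction to 3-domination. The edge count precedes the edges in the        *)
(* encoding, so the machine first stores the whole input; it executes O(s)    *)
(* instructions on numbers that are O(s).                                     *)

From mathcomp Require Import all_boot zify.
Require Import Defs.

Set Implicit Arguments.
Unset Strict Implicit.
Unset Printing Implicit Defensive.

(** * Structured programs for the machine *)

(** Two vertices cannot include all three copies of an element, so if they dominate all copies, each
    element, dummy included, has a copy adjacent to one of them, and only set vertices are adjacent
    to copies. The dummy yields a set even when X is empty, and that set replaces a vertex that is
    not a set ([two_coverable_of_dom]). Conversely, the vertices of two covering sets dominate every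
    copy ([dom_of_two_coverable]). For triples, the pendants force the hub in ([hub_forced]); it is
    adjacent to no copy but dominates all sets and pendants, so the other two vertices face the
    subset problem.

    For the time, [run_compile] turns a bound k on the instructions of a structured program and a
    bound M on all charged numbers into the cost 5 k [bitlen M]. Here k = O(s) and M = 4 s + 30,
    which gives O(s log s). Outputs are translated by reading the leading bit of the encoding, which
    tells whether a solution exists. *)

Inductive cmd :=
  | Block of seq instr
  | Seq of cmd & cmd
  | While of nat & cmd.

(* Register 0 is assumed to hold 0, so that [Jzero 0 l] is an unconditional jump. *)
Fixpoint compile (l : nat) (c : cmd) : program :=
  match c with
  | Block b => b
  | Seq c1 c2 => let p := compile l c1 in p ++ compile (l + size p) c2
  | While i c1 => let p := compile l.+1 c1 in
                  Jzero i (l + size p).+2 :: p ++ [:: Jzero 0 l]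
  end.

(* Memory (all registers beyond the list are 0), remaining input, output. *)
Definition config := (seq nat * seq nat * seq nat)%type.

Definition exec_instr (s : config) (a : instr) : config :=
  let: (m, x, y) := s in
  match a with
  | Const i c => (set_nth 0 m i c, x, y)
  | Add i j k => (set_nth 0 m i (nth 0 m j + nth 0 m k), x, y)
  | Sub i j k => (set_nth 0 m i (nth 0 m j - nth 0 m k), x, y)
  | Fetch i j => (set_nth 0 m i (nth 0 m (nth 0 m j)), x, y)
  | Store i j => (set_nth 0 m (nth 0 m i) (nth 0 m j), x, y)
  | Jzero _ _ => s
  | Read i    => (set_nth 0 m i (head 0 x), behead x, y)
  | Write i   => (m, x, rcons y (nth 0 m i))
  end.

(* Every quantity whose bit length is charged is at most [M]; jumps are only  *)
(* generated by [While].                                                      *)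
Definition instr_ok (M : nat) (s : config) (a : instr) : Prop :=
  let: (m, x, y) := s in
  match a with
  | Const i c => i <= M /\ c <= M
  | Add i j k | Sub i j k =>
      [/\ i <= M, j <= M, k <= M, nth 0 m j <= M & nth 0 m k <= M]
  | Fetch i j =>
      [/\ i <= M, j <= M, nth 0 m j <= M & nth 0 m (nth 0 m j) <= M]
  | Store i j => [/\ i <= M, j <= M, nth 0 m i <= M & nth 0 m j <= M]
  | Jzero _ _ => False
  | Read i    => i <= M /\ head 0 x <= M
  | Write i   => i <= M /\ nth 0 m i <= M
  end.

Fixpoint block_ok (M : nat) (s : config) (b : seq instr) : Prop :=
  if b is a :: b' then instr_ok M s a /\ block_ok M (exec_instr s a) b'
  else True.

(* [run M c s k s']: c leads from s to s' in at most k instructions, all of   *)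
(* whose charged quantities are at most M.                                    *)
Inductive run (M : nat) : cmd -> config -> nat -> config -> Prop :=
  | RunBlock b s : block_ok M s b ->
      run M (Block b) s (size b) (foldl exec_instr s b)
  | RunSeq c1 c2 s1 k1 s2 k2 s3 :
      run M c1 s1 k1 s2 -> run M c2 s2 k2 s3 ->
      run M (Seq c1 c2) s1 (k1 + k2) s3
  | RunWhile0 i c s : i <= M -> nth 0 s.1.1 i = 0 -> run M (While i c) s 1 s
  | RunWhileS i c s1 k1 s2 k2 s3 :
      i <= M -> 0 < nth 0 s1.1.1 i <= M ->
      run M c s1 k1 s2 -> nth 0 s2.1.1 0 = 0 ->
      run M (While i c) s2 k2 s3 ->
      run M (While i c) s1 (k1 + 2 + k2) s3
  | RunLe c s k k' s' : k <= k' -> run M c s k s' -> run M c s k' s'.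

Definition state_of (l : nat) (r : nat -> nat) (s : config) : state :=
  State l r s.1.2 s.2.

(** * Correctness and cost of compiled programs *)

Lemma leq_bitlen m n : m <= n -> bitlen m <= bitlen n.
Proof. by move=> mn; rewrite ltnS leq_trunc_log. Qed.

Lemma upd_set_nth (r : nat -> nat) m i v :
  r =1 nth 0 m -> upd r i v =1 nth 0 (set_nth 0 m i v).
Proof. by move=> rm j; rewrite nth_set_nth /upd /= rm. Qed.

(** The factor 5 comes from [Add] and [Sub], which are charged for five numbers; no instruction is
    charged for more. *)
Lemma exec_instr_step M l r s a :
  r =1 nth 0 s.1.1 -> instr_ok M s a ->
  exists2 r', step_instr a (state_of l r s) = state_of l.+1 r' (exec_instr s a) &
    r' =1 nth 0 (exec_instr s a).1.1 /\
    cost_instr a (state_of l r s) <= 5 * bitlen M.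
Proof.
have B := @leq_bitlen _ M; move: s => [[m x] y] /= rm.
case: a => [i c|i j k|i j k|i j|i j|i j|i|i] //=; rewrite ?rm; case.
- by move=> /B ? /B ?; eexists; [reflexivity|split; [exact: upd_set_nth|lia]].
- by move=> /B ? /B ? /B ? /B ? /B ?; eexists; [reflexivity|split; [exact: upd_set_nth|lia]].
- by move=> /B ? /B ? /B ? /B ? /B ?; eexists; [reflexivity|split; [exact: upd_set_nth|lia]].
- by move=> /B ? /B ? /B ? /B ?; eexists; [reflexivity|split; [exact: upd_set_nth|lia]].
- by move=> /B ? /B ? /B ? /B ?; eexists; [reflexivity|split; [exact: upd_set_nth|lia]].
- by move=> /B ? /B ?; eexists; [reflexivity|split; [exact: upd_set_nth|lia]].
- by move=> /B ? /B ?; eexists; [reflexivity|split; [exact: rm|lia]].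
Qed.

Lemma runs_instr p1 a p2 s t s' : pc s = size p1 ->
  runs (p1 ++ a :: p2) (step_instr a s) t s' ->
  runs (p1 ++ a :: p2) s (cost_instr a s + t) s'.
Proof.
move=> pcs rs; have := @Runs_step (p1 ++ a :: p2) s t s'.
by rewrite pcs nth_cat ltnn subnn /= size_cat /= addnS ltnS leq_addr; apply.
Qed.

(** Since [runs] only describes halting computations, a partial computation is expressed by
    prepending it to an arbitrary halting continuation. *)
Definition reaches (p : program) l r s t l' r' s' : Prop :=
  forall t' sf, runs p (state_of l' r' s') t' sf ->
                runs p (state_of l r s) (t + t') sf.

Lemma block_reaches M b s p1 p2 r :
  block_ok M s b -> r =1 nth 0 s.1.1 ->
  exists t r',
    [/\ t <= size b * (5 * bitlen M), r' =1 nth 0 (foldl exec_instr s b).1.1 &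
        reaches (p1 ++ b ++ p2) (size p1) r s t
          (size p1 + size b) r' (foldl exec_instr s b)].
Proof.
elim: b s p1 r => [|a b IH] s p1 r /=.
  by move=> _ rm; exists 0, r; split=> // t' sf; rewrite addn0.
case=> oka okb rm; have [r1 e1 [rm1 c1]] := exec_instr_step (size p1) rm oka.
have [t [r' [le_t rm' re]]] := IH _ (rcons p1 a) _ okb rm1.
exists (cost_instr a (state_of (size p1) r s) + t), r'; split=> //.
  by rewrite mulSn leq_add.
move=> t' sf h; rewrite -addnA; apply: runs_instr => //; rewrite e1.
move: re; rewrite /reaches size_rcons cat_rcons => re; apply: re.
by rewrite addSnnS.
Qed.

(** Induction on the derivation of [run]. Jump targets are absolute, so the code is compiled for the
    address [size p1] at which it sits, between arbitrary [p1] and [p2]. *)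
Lemma run_compile M c s k s' : run M c s k s' ->
  forall p1 p2 r, r =1 nth 0 s.1.1 ->
  exists t r',
    [/\ t <= k * (5 * bitlen M), r' =1 nth 0 s'.1.1 &
        reaches (p1 ++ compile (size p1) c ++ p2) (size p1) r s t
          (size p1 + size (compile (size p1) c)) r' s'].
Proof.
elim=> {c s k s'} [b s ok|c1 c2 s1 k1 s2 k2 s3 _ IH1 _ IH2|i c s le_i s0
  |i c s1 k1 s2 k2 s3 le_i s1i _ IH1 s20 _ IH2|c s k k' s' le_k _ IH] p1 p2 r rm.
- exact: block_reaches.
- rewrite /=; set q1 := compile _ c1; set q2 := compile _ c2.
  have [t1 [r1 [le1 rm1 re1]]] := IH1 p1 (q2 ++ p2) r rm.
  have [t2 [r2 [le2 rm2 re2]]] := IH2 (p1 ++ q1) p2 r1 rm1.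
  rewrite size_cat -/q2 -catA in re2.
  exists (t1 + t2), r2; split=> //; first by rewrite mulnDl leq_add.
  move=> t' sf; rewrite -catA size_cat addnA => h; rewrite -addnA.
  by apply: re1; apply: re2.
- rewrite /=; set q := compile _ c.
  exists (bitlen i + bitlen (r i)), r; split=> //.
    by rewrite rm s0; have := leq_bitlen le_i; have := leq_bitlen (leq0n M); lia.
  move=> t' sf h; apply: runs_instr => //=; rewrite rm s0 eqxx /=.
  by move: h; rewrite /= size_cat /= addn1 !addnS.
- rewrite /=; set q := compile _ c.
  have [t1 [r1 [le1 rm1 re1]]] :=
    IH1 (rcons p1 (Jzero i (size p1 + size q).+2)) (Jzero 0 (size p1) :: p2) r rm.
  have [t2 [r2 [le2 rm2 re2]]] := IH2 p1 p2 r1 rm1.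
  rewrite size_rcons cat_rcons -/q in re1.
  rewrite /= -/q -catA /= in re2; rewrite -catA /=.
  exists (bitlen i + bitlen (r i) + (t1 + (bitlen 0 + bitlen (r1 0) + t2))), r2.
  split=> //.
    case/andP: s1i => _ s1i; rewrite rm rm1 s20.
    have := leq_bitlen le_i; have := leq_bitlen s1i.
    have := leq_bitlen (leq0n M); rewrite !mulnDl; lia.
  move=> t' sf h; rewrite -!addnA addnA; apply: runs_instr => //=.
  rewrite rm; case: eqP s1i => [->//|_ _]; apply: re1.
  (* The jump closing the loop is taken because register 0 holds 0 after the body. *)
  have := @runs_instr (p1 ++ Jzero i (size p1 + size q).+2 :: q)
    (Jzero 0 (size p1)) p2 (state_of (size p1 + size q).+1 r1 s2).
  rewrite /= rm1 s20 eqxx -!catA /= size_cat /= addnS addSn => /(_ _ sf erefl).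
  by rewrite addnA; apply; apply: re2.
- have [t [r' [le_t rm' re]]] := IH p1 p2 r rm; exists t, r'; split=> //.
  by rewrite (leq_trans le_t) ?leq_mul2r ?le_k ?orbT.
Qed.

Lemma run_computes M c x k m x' y b : run M c (nseq b 0, x, [::]) k (m, x', y) ->
  exists2 t, computes (compile 0 c) x t y & t <= k * (5 * bitlen M).
Proof.
move/run_compile => /(_ [::] [::] (fun=> 0)) [i|t [r [le_t _]]].
  by rewrite nth_nseq if_same.
rewrite /reaches /= cats0 add0n => re; exists t => //.
exists (State (size (compile 0 c)) r x' y) => //.
by rewrite -(addn0 t); apply: re; apply: Runs_halt.
Qed.

(** * The program of the reduction *)

(* Vertices: copy k < 3 of the element x is 3 x + k, where x = n is the dummy  *)
(* element; the hub is 3 n + 3; the sets, then the four pendant vertices,     *)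
(* follow from 3 n + 4 on. [nbr_lists] lists the neighbours of the latter.    *)
Definition copies (c : seq nat) : seq nat :=
  flatten [seq [:: 3 * x; 3 * x + 1; 3 * x + 2] | x <- c].

Definition nbr_lists (n : nat) (css : seq (seq nat)) : seq (seq nat) :=
  [seq (3 * n + 3) :: copies (n :: c) | c <- css] ++ nseq 4 [:: 3 * n + 3].

Fixpoint rows (v : nat) (ls : seq (seq nat)) : seq (nat * nat) :=
  if ls is l :: ls' then [seq (u, v) | u <- l] ++ rows v.+1 ls' else [::].

(** There are 3 (n + 1) copies, the hub, m sets and 4 pendants; the outer successor allows [inord]
    to build vertices. *)
Definition cover_order (n m : nat) : nat := (3 * n + m + 7).+1.

Definition cover_edges (n : nat) (css : seq (seq nat)) : seq (nat * nat) :=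
  rows (3 * n + 4) (nbr_lists n css).

Definition enc_edges (es : seq (nat * nat)) : seq nat :=
  flatten [seq [:: e.1; e.2] | e <- es].

Definition enc_lists (css : seq (seq nat)) : seq nat :=
  flatten [seq size c :: c | c <- css].

(* Registers: 1 = one, 2 = n, 3 = number of sets, 4 = memory pointer,          *)
(* 5, 6 = loop counters, 7, 8 = scratch, 9 = current right vertex, 10 = hub;  *)
(* the input lists are stored from register 11 on.                            *)
Definition load_set : cmd :=
  While 6 (Block [:: Read 7; Store 4 7; Add 4 4 1; Sub 6 6 1]).

Definition load : cmd :=
  While 5 (Seq (Block [:: Read 6; Store 4 6; Add 4 4 1])
          (Seq load_set (Block [:: Sub 5 5 1]))).

Definition emit_copies : seq instr :=
  [:: Add 8 7 7; Add 8 8 7; Write 8; Write 9;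
      Add 8 8 1; Write 8; Write 9; Add 8 8 1; Write 8; Write 9].

Definition emit_set : cmd :=
  While 6 (Block ([:: Fetch 7 4; Add 4 4 1] ++ emit_copies ++ [:: Sub 6 6 1])).

Definition emit : cmd :=
  While 5 (Seq (Block ([:: Fetch 6 4; Add 4 4 1; Write 10; Write 9; Add 7 2 0]
                       ++ emit_copies))
          (Seq emit_set (Block [:: Add 9 9 1; Sub 5 5 1]))).

Definition cover_cmd : cmd :=
  Seq (Block [:: Const 1 1; Read 2; Read 3; Const 4 11; Add 5 3 0])
  (Seq load
  (Seq (Block [:: Add 10 2 1; Add 7 10 10; Add 10 10 7; Add 9 10 1;
                  Add 7 9 3; Const 8 4; Add 7 7 8; Write 7])
  (Seq (Block [:: Const 7 11; Sub 4 4 7; Add 7 4 4; Add 7 7 4; Add 7 7 3;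
                  Add 7 7 8; Write 7; Const 4 11; Add 5 3 0])
  (Seq emit
  (Block [:: Write 10; Write 9; Add 9 9 1; Write 10; Write 9; Add 9 9 1;
             Write 10; Write 9; Add 9 9 1; Write 10; Write 9]))))).

Definition subset_cmd : cmd :=
  Seq cover_cmd
  (Seq (Block [:: Add 5 10 0; Const 9 0; Write 10])
  (While 5 (Block [:: Write 9; Add 9 9 1; Sub 5 5 1]))).

(** * Runs of the reduction programs *)

Lemma run_block M b s s' : block_ok M s b -> foldl exec_instr s b = s' ->
  run M (Block b) s (size b) s'.
Proof. by move=> ok <-; apply: RunBlock. Qed.

Lemma set_nth_size (ms : seq nat) v : set_nth 0 ms (size ms) v = rcons ms v.
Proof. by elim: ms => //= w ms ->. Qed.

Lemma nth_middle (pre suf : seq nat) v : nth 0 (pre ++ v :: suf) (size pre) = v.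
Proof. by rewrite nth_cat ltnn subnn. Qed.

Ltac seq_eq :=
  repeat first [reflexivity | apply: (f_equal2 (@cons nat)); [lia|]].

(** The list [ms] is what is already stored from register 11 on; storing at the pointer
    [11 + size ms] appends to it. *)
Lemma load_set_run M n m k c : 20 <= M -> all (leq^~ M) c ->
  forall ms t rest y, 11 + size ms + size c <= M ->
  run M load_set
    ([:: 0, 1, n, m, 11 + size ms, k, size c, t, 0, 0, 0 & ms], c ++ rest, y)
    (6 * size c + 1)
    ([:: 0, 1, n, m, 11 + size (ms ++ c), k, 0, last t c, 0, 0, 0 & ms ++ c],
     rest, y).
Proof.
move=> M20; elim: c => [_|x c IH /andP[xM cM]] ms t rest y sM.
  by rewrite cats0; apply: RunWhile0 => //; lia.
rewrite /= in sM; apply: (@RunLe _ _ _ (4 + 2 + (6 * size c + 1))).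
  by rewrite /=; lia.
apply: RunWhileS; [lia|by rewrite /=; lia|apply: run_block; last reflexivity| |].
- by rewrite /= ?set_nth_size /=; do ![split=> //]; lia.
- by rewrite /= ?set_nth_size.
- rewrite /= ?set_nth_size /=.
  have := IH cM (rcons ms x) x rest y.
  rewrite size_rcons -cats1 -catA /= subn1 !addn1 addnS /=; apply; lia.
Qed.

Lemma leq_size_enc_lists css : size css <= size (enc_lists css).
Proof.
elim: css => //= c css IH; rewrite ltnS size_cat.
exact: leq_trans IH (leq_addl _ _).
Qed.

Lemma load_run M n m css : 20 <= M -> all (all (leq^~ M)) css ->
  forall ms t6 t rest y, 11 + size ms + size (enc_lists css) <= M ->
  exists t6' t', run M load
    ([:: 0, 1, n, m, 11 + size ms, size css, t6, t, 0, 0, 0 & ms],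
     enc_lists css ++ rest, y)
    (20 * size (enc_lists css) + 1)
    ([:: 0, 1, n, m, 11 + size (ms ++ enc_lists css), 0, t6', t', 0, 0, 0
       & ms ++ enc_lists css], rest, y).
Proof.
move=> M20; elim: css => [_|c css IH /andP[cM cssM]] ms t6 t rest y.
  by exists t6, t; rewrite cats0; apply: RunWhile0 => //; lia.
rewrite /enc_lists /= -/(enc_lists css) size_cat => sM.
have [|t6' [t' IHr]] := IH cssM (rcons ms (size c) ++ c) 0 (last t c) rest y.
  by rewrite size_cat size_rcons; lia.
exists t6', t'.
have szcss := leq_size_enc_lists css.
apply: (@RunLe _ _ _ ((3 + ((6 * size c + 1) + 1)) + 2
                     + (20 * size (enc_lists css) + 1))); first lia.
apply: RunWhileS; [lia|by rewrite /=; lia| | |].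
- apply: RunSeq; first (apply: run_block; last reflexivity).
    by rewrite /= ?set_nth_size /=; do ![split=> //]; lia.
  apply: RunSeq.
    rewrite /= ?set_nth_size /= -catA.
    have := @load_set_run M n m (size css).+1 c M20 cM (rcons ms (size c)) t
      (enc_lists css ++ rest) y.
    rewrite size_rcons addnS !addn1; apply; lia.
  by apply: run_block; last reflexivity; rewrite /=; do ![split=> //]; lia.
- by [].
- by move: IHr; rewrite /= subn1 -cats1 -!catA.
Qed.

Lemma enc_edges_cat e1 e2 : enc_edges (e1 ++ e2) = enc_edges e1 ++ enc_edges e2.
Proof. by rewrite /enc_edges map_cat flatten_cat. Qed.

Lemma enc_edges_copies_cons v z c :
  enc_edges [seq (u, v) | u <- copies (z :: c)] =
  [:: z + z + z, v, z + z + z + 1, v, z + z + z + 1 + 1, v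
    & enc_edges [seq (u, v) | u <- copies c]].
Proof. rewrite /copies /enc_edges /=; seq_eq. Qed.

Lemma emit_set_run M n m k v a c : 20 <= M -> v <= M ->
  all (fun x => 3 * x + 2 <= M) c ->
  forall pre t7 t8 suf x y, 11 + size pre + size c <= M ->
  exists t7' t8', run M emit_set
    ([:: 0, 1, n, m, 11 + size pre, k, size c, t7, t8, v, a & pre ++ c ++ suf],
     x, y)
    (15 * size c + 1)
    ([:: 0, 1, n, m, 11 + size (pre ++ c), k, 0, t7', t8', v, a
       & pre ++ c ++ suf], x, y ++ enc_edges [seq (u, v) | u <- copies c]).
Proof.
move=> M20 vM; elim: c => [_|z c IH /andP[zM cM]] pre t7 t8 suf x y sM.
  by exists t7, t8; rewrite !cats0; apply: RunWhile0 => //; lia.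
rewrite /= in sM.
have [|t7' [t8' IHr]] := IH cM (rcons pre z) z (z + z + z + 1 + 1) suf x
  (y ++ [:: z + z + z; v; z + z + z + 1; v; z + z + z + 1 + 1; v]).
  by rewrite size_rcons; lia.
exists t7', t8'.
apply: (@RunLe _ _ _ (13 + 2 + (15 * size c + 1))); first by rewrite /=; lia.
apply: RunWhileS; [lia|by rewrite /=; lia|apply: run_block; last reflexivity| |].
- by rewrite /= ?nth_middle /=; do ![split=> //]; lia.
- by [].
- rewrite /= ?nth_middle /=.
  move: IHr; rewrite size_rcons addnS enc_edges_copies_cons -!cats1 -!catA /=.
  by rewrite !addn1 subn1.
Qed.

Lemma emit_run M n m a css : 20 <= M -> 3 * n + 2 <= M -> a <= M ->
  all (all (fun x => 3 * x + 2 <= M)) css ->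
  forall pre t6 t7 t8 v x y, 11 + size (pre ++ enc_lists css) <= M ->
  v + size css <= M ->
  exists t6' t7' t8', run M emit
    ([:: 0, 1, n, m, 11 + size pre, size css, t6, t7, t8, v, a
       & pre ++ enc_lists css], x, y)
    (40 * size (enc_lists css) + 1)
    ([:: 0, 1, n, m, 11 + size (pre ++ enc_lists css), 0, t6', t7', t8',
         v + size css, a & pre ++ enc_lists css], x,
     y ++ enc_edges (rows v [seq a :: copies (n :: c) | c <- css])).
Proof.
move=> M20 nM aM; elim: css => [_|c css IH /andP[cM cssM]] pre t6 t7 t8 v x y.
  move=> sM vM; exists t6, t7, t8; rewrite /= !cats0 addn0.
  by apply: RunWhile0 => //; lia.
rewrite /enc_lists /= -/(enc_lists css) !size_cat /= size_cat => sM vM.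
have szcss := leq_size_enc_lists css.
have [||t71 [t81 E]] := @emit_set_run M n m (size css).+1 v a c M20 _ cM
  (rcons pre (size c)) n (n + n + n + 1 + 1) (enc_lists css) x
  (y ++ [:: a; v; n + n + n; v; n + n + n + 1; v; n + n + n + 1 + 1; v]).
- lia.
- by rewrite size_rcons; lia.
have [||t6' [t7' [t8' IHr]]] := IH cssM (rcons pre (size c) ++ c) 0 t71 t81 v.+1 x
  (y ++ a :: v :: enc_edges [seq (u, v) | u <- copies (n :: c)]).
- by rewrite !size_cat size_rcons; lia.
- lia.
exists t6', t7', t8'.
apply: (@RunLe _ _ _ (15 + (15 * size c + 1 + 2) + 2
                     + (40 * size (enc_lists css) + 1))); first lia.
apply: RunWhileS; [lia|by rewrite /=; lia| | |].
- apply: RunSeq; first (apply: run_block; last reflexivity).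
    by rewrite /= ?nth_middle /=; do ![split=> //]; lia.
  apply: RunSeq.
    rewrite /= ?nth_middle /= addn0.
    by move: E; rewrite size_rcons addnS -!cats1 -!catA /= !addn1; apply.
  by apply: run_block; last reflexivity; rewrite /=; do ![split=> //]; lia.
- by [].
- rewrite -[enc_edges (_ :: _)]/(enc_edges
    (((a, v) :: [seq (u, v) | u <- copies (n :: c)])
     ++ rows v.+1 [seq a :: copies (n :: d) | d <- css])) enc_edges_cat.
  rewrite -[enc_edges (_ :: _)]
    /([:: a, v & enc_edges [seq (u, v) | u <- copies (n :: c)]]).
  move: IHr; rewrite enc_edges_copies_cons addSnnS !size_cat -!cats1 -!catA /=.
  rewrite subn1 !addn1 !size_cat /=.
  by congr (run M _ (_, _, _) _ (_, _, _)); seq_eq.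
Qed.

Lemma size_copies c : size (copies c) = 3 * size c.
Proof. by elim: c => //= x c; rewrite /copies /= => ->; lia. Qed.

Lemma size_rows v ls : size (rows v ls) = sumn (map size ls).
Proof. by elim: ls v => //= l ls IH v; rewrite size_cat size_map IH. Qed.

(** The vertex of a set c contributes the hub edge and 3 (|c| + 1) copy edges, and |c| + 1 is the
    length of the encoding of c. Hence the program can compute the edge count from the final load
    pointer before writing any edge. *)
Lemma size_cover_edges n css :
  size (cover_edges n css) = 3 * size (enc_lists css) + size css + 4.
Proof.
rewrite /cover_edges size_rows map_cat sumn_cat -map_comp.
rewrite (eq_map (g := fun c => 3 * size c + 4)) => [|c].
  by congr addn; elim: css => //= c css ->; rewrite size_cat -/(enc_lists _); lia.
by rewrite /= -/(copies (n :: c)) size_copies /=; lia.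
Qed.

Lemma rows_cat v ls ls' : rows v (ls ++ ls') = rows v ls ++ rows (v + size ls) ls'.
Proof.
by elim: ls v => [|l ls IH] v /=; rewrite ?addn0 // IH addSnnS catA.
Qed.

Lemma cover_cmd_run M n css D : D = n + size (enc_lists css) ->
  4 * D + 30 <= M -> all (all (ltn^~ n)) css ->
  exists r4 r6 r7 r8 r9 ms, run M cover_cmd
    (nseq 11 0, [:: n, size css & enc_lists css], [::])
    (100 * D.+1)
    ([:: 0, 1, n, size css, r4, 0, r6, r7, r8, r9, 3 * n + 3 & ms], [::],
     [:: cover_order n (size css), size (cover_edges n css)
       & enc_edges (cover_edges n css)]).
Proof.
move=> DE DM cssn; have szcss := leq_size_enc_lists css.
have allW K : 3 * n + 2 <= K -> all (all (fun x => 3 * x + 2 <= K)) css.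
  move=> nK; apply: sub_all cssn => c; apply: sub_all => x /= xn; lia.
have [|||t6 [t7 L]] := @load_run M n (size css) css _ _ [::] 0 0 [::] [::].
- lia.
- apply: sub_all cssn => c; apply: sub_all => x /= xn; lia.
- by rewrite /=; lia.
(* Registers 7 and 8 still hold the edge count and the constant 4 when [emit] starts. *)
have [||||||t6' [t7' [t8' E]]] := @emit_run M n (size css) (3 * n + 3) css
  _ _ _ (allW M _) [::] t6 (size (cover_edges n css)) 4 (3 * n + 4) [::]
  [:: cover_order n (size css); size (cover_edges n css)].
all: rewrite ?cat0s; try lia.
do 6!eexists.
apply: (@RunLe _ _ _ (5 + ((20 * size (enc_lists css) + 1) + (8 + (9 +
   ((40 * size (enc_lists css) + 1) + 11)))))); first lia.
apply: RunSeq; first (apply: run_block; last reflexivity).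
  by rewrite /=; do ![split=> //]; lia.
apply: RunSeq; first by rewrite /= addn0; move: L; rewrite cats0; apply.
move: E; rewrite {L allW cssn} size_cover_edges cat0s => E.
apply: (@RunSeq _ _ _ _ _
  ([:: 0, 1, n, size css, 11 + size (enc_lists css), 0, t6,
       cover_order n (size css), 4, 3 * n + 4, 3 * n + 3 & enc_lists css],
   [::], [:: cover_order n (size css)])).
  apply: run_block; first by rewrite /=; do ![split=> //]; lia.
  by rewrite /= /cover_order; congr (_, _, _); seq_eq.
apply: (@RunSeq _ _ _ _ _
  ([:: 0, 1, n, size css, 11, size css, t6,
       3 * size (enc_lists css) + size css + 4, 4, 3 * n + 4, 3 * n + 3
     & enc_lists css], [::],
   [:: cover_order n (size css); 3 * size (enc_lists css) + size css + 4])).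
  apply: run_block.
    by rewrite /= /cover_order; do ![split=> //]; lia.
  by rewrite /=; congr (_, _, _); seq_eq.
apply: RunSeq; first exact: E.
apply: run_block; first by rewrite /=; do ![split=> //]; lia.
rewrite /=; apply: (f_equal2 pair); first reflexivity.
rewrite /cover_edges /nbr_lists rows_cat size_map enc_edges_cat.
rewrite -!cats1 -!catA; congr [:: _, _ & _ ++ _].
by rewrite /= /enc_edges /= !addn1.
Qed.

(** The copies are numbered below the hub, so the hub number in register 10 is also the cardinality
    of the subset and the loop count. *)
Lemma subset_cmd_run M n css D : D = n + size (enc_lists css) ->
  4 * D + 30 <= M -> all (all (ltn^~ n)) css ->
  exists m', run M subset_cmd
    (nseq 11 0, [:: n, size css & enc_lists css], [::])
    (200 * D.+1)
    (m', [::],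
     [:: cover_order n (size css), size (cover_edges n css)
       & enc_edges (cover_edges n css)]
     ++ (3 * n + 3) :: iota 0 (3 * n + 3)).
Proof.
move=> DE DM cssn.
have [r4 [r6 [r7 [r8 [r9 [ms C]]]]]] := cover_cmd_run DE DM cssn.
exists [:: 0, 1, n, size css, r4, 0, r6, r7, r8, 3 * n + 3, 3 * n + 3 & ms].
rewrite -cat_rcons; move: [:: cover_order _ _, _ & _] C => y C.
apply: (@RunLe _ _ _ (100 * D.+1 + (3 + (5 * (3 * n + 3) + 1)))); first lia.
apply: RunSeq; first exact: C.
apply: RunSeq; first (apply: run_block; last reflexivity).
  by rewrite /=; do ![split=> //]; lia.
rewrite /= addn0; move: (rcons _ _) => {C} {}y.
suff L k j y' : k + j = 3 * n + 3 ->
    run M (While 5 (Block [:: Write 9; Add 9 9 1; Sub 5 5 1]))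
      ([:: 0, 1, n, size css, r4, k, r6, r7, r8, j, 3 * n + 3 & ms], [::], y')
      (5 * k + 1)
      ([:: 0, 1, n, size css, r4, 0, r6, r7, r8, 3 * n + 3, 3 * n + 3 & ms], [::],
       y' ++ iota j k) by apply: L; rewrite addn0.
elim: k j y' => [|k IH] j y' kj.
  by rewrite cats0 -kj; apply: RunWhile0 => //; lia.
apply: (@RunLe _ _ _ (3 + 2 + (5 * k + 1))); first lia.
apply: RunWhileS; [lia|by rewrite /=; lia|apply: run_block; last reflexivity| |].
- by rewrite /=; do ![split=> //]; lia.
- by [].
- by rewrite /= subn1 addn1 -cat_rcons; apply: IH; lia.
Qed.

(** * The graph of the reduction *)

(** The default [[::]] of [nth] excludes every w beyond the last list. *)
Lemma mem_rows v ls u w :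
  ((u, w) \in rows v ls) = (v <= w) && (u \in nth [::] ls (w - v)).
Proof.
elim: ls v => [|l ls IH] v /=; first by rewrite nth_nil !in_nil andbF.
rewrite mem_cat IH; case: (ltngtP v w) => [vw|wv|->].
- have -> : w - v = (w - v.+1).+1 by lia.
  by rewrite (_ : _ \in _ = false) //; apply/mapP => -[z _ [_ e]]; lia.
- by rewrite orbF; apply/mapP => -[z _ [_ e]]; lia.
- rewrite orbF subnn /=; apply/mapP/idP => [[z zl [->//]]|ul]; by exists u.
Qed.

Lemma uniq_rows v ls : all uniq ls -> uniq (rows v ls).
Proof.
elim: ls v => //= l ls IH v /andP[ul uls]; rewrite cat_uniq IH // andbT.
rewrite map_inj_uniq ?ul /=; last by move=> ? ? [].
apply/hasPn => -[u w]; rewrite mem_rows => /andP[vw _].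
by apply/mapP => -[z _ [_ e]]; lia.
Qed.

Lemma mem_copies u c : (u \in copies c) = (u %/ 3 \in c).
Proof.
elim: c => //= x c; rewrite /copies /= !in_cons => ->.
by rewrite !orbA; congr (_ || _); lia.
Qed.

Lemma uniq_copies c : uniq c -> uniq (copies c).
Proof.
elim: c => //= x c IH /andP[xc uc]; rewrite /copies /= -/(copies c).
rewrite IH // andbT !in_cons !mem_copies.
have -> : (3 * x) %/ 3 = x by lia.
have -> : (3 * x + 1) %/ 3 = x by lia.
have -> : (3 * x + 2) %/ 3 = x by lia.
by rewrite (negPf xc); lia.
Qed.

Lemma mem_cover_edges n css u w :
  ((u, w) \in cover_edges n css) = (3 * n + 4 <= w) &&
    (((u == 3 * n + 3) && (w < 3 * n + size css + 8))
     || (w < 3 * n + size css + 4) &&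
        (u %/ 3 \in n :: nth [::] css (w - (3 * n + 4)))).
Proof.
rewrite mem_rows; case: (leqP (3 * n + 4) w) => //= le_w; rewrite /nbr_lists nth_cat size_map.
case: (ltnP (w - (3 * n + 4)) (size css)) => lt_m.
  rewrite (nth_map [::]) // inE mem_copies.
  have -> : w < 3 * n + size css + 8 by lia.
  have -> : w < 3 * n + size css + 4 by lia.
  by rewrite andbT.
have -> : w < 3 * n + size css + 4 = false by lia.
rewrite nth_nseq orbF; case: (ltnP _ 4) => h.
  by rewrite inE (_ : w < _) ?andbT //; lia.
by rewrite in_nil; apply/esym/negbTE; lia.
Qed.

Lemma val_enum_lt_set N K : K <= N ->
  [seq val x | x <- enum [set u : 'I_N | u < K]] = iota 0 K.
Proof.
move=> KN; rewrite -[RHS](filter_iota_ltn 0 KN) -val_enum_ord filter_map.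
rewrite /enum_mem -filter_predI; congr map; apply: eq_filter => u.
by rewrite /= !inE add0n ?andbT.
Qed.

Section CoverGraph.

Variable S : set_system.
Local Notation n := (ground S).
Local Notation m := (size (coll S)).

Definition set_lists : seq (seq nat) :=
  [seq [seq val x | x <- enum C] | C : {set 'I_n} <- coll S].

Lemma nth_set_lists j x : j < m ->
  (x \in nth [::] set_lists j) =
  [exists y in nth set0 (coll S) j, val y == x].
Proof.
move=> jm; rewrite (nth_map set0) //; apply/mapP/existsP.
  by case=> y; rewrite mem_enum => yC ->; exists y; rewrite yC eqxx.
by case=> y /andP[yC /eqP <-]; exists y; rewrite ?mem_enum.
Qed.

Lemma set_lists_lt : all (all (ltn^~ n)) set_lists.
Proof.
by apply/allP => _ /mapP[C _ ->]; apply/allP => _ /mapP[x _ ->] /=.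
Qed.

Local Notation E := (cover_edges n set_lists).

(** The hub number separates the sides: copies and hub on the left, sets and pendants on the right.
    This gives both the orientation of the edges and the bipartition. *)
Lemma cover_edges_bound e : e \in E ->
  e.1 <= 3 * n + 3 < e.2 /\ e.2 < cover_order n m.
Proof.
case: e => u w; rewrite mem_cover_edges size_map /cover_order.
case/andP=> le_w /orP[/andP[/eqP -> lt_w]|/andP[lt_w u3]] /=; first by lia.
suff : u %/ 3 <= n by lia.
move: u3; rewrite inE => /orP[/eqP -> //|u3].
have /allP/(_ _ (mem_nth [::] _)) := set_lists_lt.
by move=> /(_ (w - (3 * n + 4))); rewrite size_map => /(_ _)/allP/(_ _ u3)/=; lia.
Qed.

Definition ord_edges : seq ('I_(cover_order n m) * 'I_(cover_order n m)) :=
  [seq (inord e.1, inord e.2) | e <- E].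

Lemma inord_edgeK e : e \in E ->
  (nat_of_ord (inord e.1 : 'I_(cover_order n m)),
   nat_of_ord (inord e.2 : 'I_(cover_order n m))) = e.
Proof.
move=> /cover_edges_bound[/andP[le1 lt2] lt_e]; rewrite !inordK //.
  by case: e {le1 lt2 lt_e}.
exact: leq_ltn_trans le1 (ltn_trans lt2 lt_e).
Qed.

Lemma ord_edges_lt :
  all (fun e : 'I_(cover_order n m) * 'I_(cover_order n m) => e.1 < e.2) ord_edges.
Proof.
apply/allP => _ /mapP[e eE ->] /=; have [h _] := cover_edges_bound eE.
by have := inord_edgeK eE; case: e h {eE} => u w /= h [-> ->]; lia.
Qed.

Lemma ord_edges_uniq : uniq ord_edges.
Proof.
rewrite map_inj_in_uniq => [|e f eE fE [h1 h2]]; last first.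
  by rewrite -(inord_edgeK eE) -(inord_edgeK fE) h1 h2.
apply: uniq_rows; rewrite all_cat /= andbT.
apply/allP => _ /mapP[_ /mapP[C _ ->] ->]; rewrite cons_uniq.
have lt_n x : x \in [seq val x | x <- enum C] -> x < n.
  by case/mapP=> y _ ->; apply: ltn_ord.
apply/andP; split; last first.
  apply: uniq_copies; rewrite /= map_inj_uniq ?enum_uniq; last exact: val_inj.
  by rewrite andbT; apply/negP => /lt_n; rewrite ltnn.
rewrite mem_copies inE negb_or; apply/andP; split; first lia.
by apply/negP => /lt_n; lia.
Qed.

Definition cover_graph : graph := Graph ord_edges_lt ord_edges_uniq.

Definition cover_adj (u v : nat) : bool := ((u, v) \in E) || ((v, u) \in E).

Lemma cover_graph_adj (u v : 'I_(order cover_graph)) : adj u v = cover_adj u v.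
Proof.
suff mem (x y : 'I_(order cover_graph)) :
    ((x, y) \in edges cover_graph) = ((x : nat, y : nat) \in E).
  by rewrite /adj !mem.
apply/mapP/idP => [[e eE [-> ->]]|xyE]; first by rewrite inord_edgeK.
by exists (x : nat, y : nat) => //=; rewrite !inord_val.
Qed.

Lemma cover_graph_bipartite : bipartite cover_graph.
Proof.
exists (fun u => u <= 3 * n + 3) => u v; rewrite cover_graph_adj.
by case/orP=> /cover_edges_bound /= [h _]; lia.
Qed.

Definition cover_bipartite_graph : bipartite_graph :=
  BipartiteGraph cover_graph_bipartite.

Definition copies_set : {set 'I_(order cover_bipartite_graph)} :=
  [set u : 'I_(order cover_bipartite_graph) | u < 3 * n + 3].

Definition cover_subset_graph : subset_graph := SubsetGraph copies_set.

Lemma enc_cover_graph : enc_graph cover_graph =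
  [:: cover_order n m, size E & enc_edges E].
Proof.
rewrite /enc_graph /= size_map /enc_edges; congr [:: _, _ & flatten _].
rewrite /ord_edges -map_comp; apply/eq_in_map => e /inord_edgeK.
by case: e => u w [] /= -> ->.
Qed.

Lemma enc_copies_set : enc_set copies_set = (3 * n + 3) :: iota 0 (3 * n + 3).
Proof.
have eI : [seq val x | x <- enum copies_set] = iota 0 (3 * n + 3).
  by apply: val_enum_lt_set; rewrite /= /cover_order; lia.
by rewrite /enc_set cardE -(size_map val) eI size_iota.
Qed.

(** * Domination versus two-coverings *)

Definition two_coverable : Prop :=
  exists C C' : {set 'I_n}, [/\ C \in coll S, C' \in coll S & [set: 'I_n] = C :|: C'].

Lemma two_coverable_of_dom v w :
  (forall u, u < 3 * n + 3 -> [|| cover_adj v u, cover_adj w u, u == v | u == w]) ->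
  two_coverable.
Proof.
move=> dom.
have adjP z u : u < 3 * n + 3 -> cover_adj z u -> exists j,
    [/\ z = 3 * n + 4 + j, j < m & u %/ 3 \in n :: nth [::] set_lists j].
  move=> lt_u; rewrite /cover_adj !mem_cover_edges size_map.
  case/orP=> /andP[le_z]; first by lia.
  case/orP=> /andP[]; first by lia.
  by move=> lt_z u3; exists (z - (3 * n + 4)); split=> //; lia.
have domx x : x <= n -> exists2 u, u %/ 3 = x &
    u < 3 * n + 3 /\ (cover_adj v u || cover_adj w u).
  move=> le_x.
  (* Pigeonhole: one of the three copies is neither v nor w. *)
  have [k [k3 kv kw]] : exists k, [/\ k < 3, 3 * x + k != v & 3 * x + k != w].
    have [/andP[? ?]|h0] := boolP ((3 * x + 0 != v) && (3 * x + 0 != w)).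
      by exists 0.
    have [/andP[? ?]|h1] := boolP ((3 * x + 1 != v) && (3 * x + 1 != w)).
      by exists 1.
    by exists 2; split; lia.
  exists (3 * x + k); first lia.
  have lt_u : 3 * x + k < 3 * n + 3 by lia.
  by split=> //; have := dom _ lt_u; rewrite (negPf kv) (negPf kw) !orbF.
(* The dummy x = n provides a set even if the ground set is empty. *)
have [C0 C0S] : exists C0, C0 \in coll S.
  have [u _ [lt_u /orP[]/(adjP _ _ lt_u)[j [_ jm _]]]] := domx _ (leqnn n);
    by exists (nth set0 (coll S) j); apply: mem_nth.
have setP z : exists2 C, C \in coll S & forall (x : 'I_n) u, u < 3 * n + 3 ->
    u %/ 3 = x -> cover_adj z u -> x \in C.
  (* A vertex that is not a set is adjacent to no copy, so [C0] serves vacuously. *)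
  have [/andP[le_z lt_z]|zN] := boolP (3 * n + 4 <= z < 3 * n + 4 + m).
    have lt_m : z - (3 * n + 4) < m by lia.
    exists (nth set0 (coll S) (z - (3 * n + 4))); first exact: mem_nth.
    move=> x u lt_u ux /(adjP _ _ lt_u)[j [zE jm]]; rewrite zE addKn ux inE.
    case/orP=> [/eqP xn|]; first by have := ltn_ord x; lia.
    by rewrite nth_set_lists // => /existsP[y /andP[yC /eqP /val_inj <-]].
  by exists C0 => // x u lt_u _ /(adjP _ _ lt_u)[j [? ? _]]; lia.
have [C CS CP] := setP v; have [C' CS' CP'] := setP w.
exists C, C'; split=> //; apply/esym/eqP; rewrite -subTset; apply/subsetP => x _.
have [u ux [lt_u /orP[a|a]]] := domx x (ltnW (ltn_ord x)); rewrite inE.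
  by rewrite (CP x u).
by rewrite (CP' x u) ?orbT.
Qed.

Lemma set_vertex_adj C u : C \in coll S ->
  (u %/ 3 == n) || [exists x in C, val x == u %/ 3] ->
  cover_adj (3 * n + 4 + index C (coll S)) u.
Proof.
move=> CS u3; have iC : index C (coll S) < m by rewrite index_mem.
rewrite /cover_adj orbC mem_cover_edges addKn inE size_map nth_set_lists //.
by rewrite nth_index // u3; lia.
Qed.

Lemma dom_of_two_coverable : two_coverable -> exists v w,
  [/\ v < cover_order n m, w < cover_order n m &
      forall u, u < 3 * n + 3 -> cover_adj v u || cover_adj w u].
Proof.
case=> C [C' [CS CS' cov]].
have bound A : A \in coll S -> 3 * n + 4 + index A (coll S) < cover_order n m.
  move=> AS; have : index A (coll S) < m by rewrite index_mem.
  by rewrite /cover_order; lia.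
exists (3 * n + 4 + index C (coll S)), (3 * n + 4 + index C' (coll S)).
split; [exact: bound|exact: bound|move=> u lt_u].
have [un|neq] := eqVneq (u %/ 3) n; first by rewrite set_vertex_adj ?un ?eqxx.
have un : u %/ 3 < n by lia.
have ex (A : {set 'I_n}) : Ordinal un \in A -> [exists y in A, val y == u %/ 3].
  by move=> uA; apply/existsP; exists (Ordinal un); rewrite uA /=.
have : Ordinal un \in C :|: C' by rewrite -cov inE.
rewrite inE => /orP[/ex h|/ex h]; first by rewrite set_vertex_adj ?h ?orbT.
by rewrite orbC set_vertex_adj ?h ?orbT.
Qed.

(** A pendant is adjacent to the hub only; without the hub, all four pendants would have to be among
    three vertices. *)
Lemma hub_forced v w x :
  (forall u, u < cover_order n m ->
    [|| cover_adj v u, cover_adj w u, cover_adj x u, u == v, u == w | u == x]) ->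
  [|| v == 3 * n + 3, w == 3 * n + 3 | x == 3 * n + 3].
Proof.
move=> dom; apply/negPn/negP; rewrite !negb_or => /and3P[vh wh xh].
have pend z k : z != 3 * n + 3 -> k < 4 -> cover_adj z (3 * n + m + 4 + k) = false.
  move=> zh k4; apply/negP => /orP[|/cover_edges_bound[/= h _]]; last by lia.
  by rewrite mem_cover_edges size_map; lia.
have {}dom k : k < 4 ->
    [|| 3 * n + m + 4 + k == v, 3 * n + m + 4 + k == w | 3 * n + m + 4 + k == x].
  move=> k4; have := dom (3 * n + m + 4 + k); rewrite !pend //=; apply.
  by rewrite /cover_order; lia.
by move: (dom 0 isT) (dom 1 isT) (dom 2 isT) (dom 3 isT); lia.
Qed.

Lemma hub_adj u : u < 3 * n + 3 -> cover_adj (3 * n + 3) u = false.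
Proof.
by move=> lt_u; rewrite /cover_adj !mem_cover_edges size_map; apply/negbTE; lia.
Qed.

Lemma hub_dom u : 3 * n + 3 < u < cover_order n m -> cover_adj (3 * n + 3) u.
Proof.
by rewrite /cover_adj !mem_cover_edges size_map /cover_order; lia.
Qed.

Lemma dominates3_two_coverable :
  (exists v w x : 'I_(order cover_graph), dominates3 v w x) <-> two_coverable.
Proof.
split=> [[v [w [x dom]]]|].
  have {}dom (u : nat) : u < cover_order n m ->
      [|| cover_adj v u, cover_adj w u, cover_adj x u, u == v, u == w | u == x].
    move=> lt_u; have : Ordinal lt_u \in [set: 'I_(order cover_graph)] by rewrite inE.
    by rewrite dom !inE !cover_graph_adj -!val_eqE /= -!orbA.
  have lt_o u : u < 3 * n + 3 -> u < cover_order n m by rewrite /cover_order; lia.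
  case/or3P: (hub_forced dom) => /eqP h.
  - apply: (@two_coverable_of_dom w x) => u lt_u; have := dom u (lt_o _ lt_u).
    by rewrite h hub_adj //; lia.
  - apply: (@two_coverable_of_dom v x) => u lt_u; have := dom u (lt_o _ lt_u).
    by rewrite h hub_adj //; lia.
  - apply: (@two_coverable_of_dom v w) => u lt_u; have := dom u (lt_o _ lt_u).
    by rewrite h hub_adj //; lia.
case/dom_of_two_coverable=> v [w [lt_v lt_w dom]].
have lt_h : 3 * n + 3 < cover_order n m by rewrite /cover_order; lia.
exists (Ordinal lt_v), (Ordinal lt_w), (Ordinal lt_h).
apply/esym/eqP; rewrite -subTset; apply/subsetP => u _.
rewrite !inE !cover_graph_adj -!val_eqE /=.
(* Copies are dominated by v or w, vertices beyond the hub by the hub, and the hub by itself. *)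
have [/dom/orP[->|->]|lt_u|->] := ltngtP (u : nat) (3 * n + 3); rewrite ?orbT //.
by rewrite hub_dom ?orbT // lt_u /=; apply: ltn_ord.
Qed.

Lemma dominates2_two_coverable :
  (exists v w : 'I_(order cover_graph), dominates2 copies_set v w) <-> two_coverable.
Proof.
split=> [[v [w /subsetP dom]]|].
  apply: (@two_coverable_of_dom v w) => u lt_u.
  have lt_o : u < cover_order n m by rewrite /cover_order; lia.
  have := dom (Ordinal lt_o); rewrite !inE !cover_graph_adj -!val_eqE /= -!orbA.
  exact.
case/dom_of_two_coverable=> v [w [lt_v lt_w dom]].
exists (Ordinal lt_v), (Ordinal lt_w); apply/subsetP => u.
by rewrite !inE !cover_graph_adj /= => /dom ->.
Qed.

Lemma enc_set_systemE : enc_set_system S = [:: n, size set_lists & enc_lists set_lists].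
Proof.
rewrite /enc_set_system size_map /enc_lists /set_lists -map_comp.
congr [:: _, _ & flatten _]; apply: eq_map => C.
by rewrite /enc_set /= size_map cardE.
Qed.

Lemma set_system_sizeE : set_system_size S = n + size (enc_lists set_lists).
Proof.
rewrite /set_system_size -addnA; congr addn; rewrite /enc_lists /set_lists.
elim: (coll S) => [|C cs IH] /=; first by rewrite big_nil.
by rewrite big_cons size_cat -IH size_map -cardE addSn addnCA.
Qed.

End CoverGraph.

(** * Time bounds, output translation and the two reductions *)

Lemma bitlen_affine s : 1 < s -> bitlen (4 * s + 30) <= 7 * trunc_log 2 s.
Proof.
move=> s1; have l1 : 0 < trunc_log 2 s by rewrite trunc_log_gt0.
suff : bitlen (4 * s + 30) <= (5 + trunc_log 2 s).+1 by lia.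
(* For s >= 2, 4 s + 30 is at most 32 s. *)
have <- : trunc_log 2 (2 * (2 * (2 * (2 * (2 * s))))) = 5 + trunc_log 2 s.
  by rewrite !trunc_logMp //; lia.
by rewrite ltnS leq_trunc_log //; lia.
Qed.

(** The constant is 70 = 2 * 5 * 7, with s + 1 <= 2 s and the 7 of [bitlen_affine]. *)
Lemma time_quasilinear k s t : t <= k * s.+1 * (5 * bitlen (4 * s + 30)) ->
  1 < s -> t <= 70 * k * (s * trunc_log 2 s ^ 1).
Proof.
move=> le_t s1; apply: leq_trans le_t _; have := bitlen_affine s1; rewrite expn1.
move: (bitlen _) (trunc_log 2 s) => b l bl.
have -> : 70 * k * (s * l) = k * (2 * s) * (5 * (7 * l)) by lia.
by rewrite !leq_mul //; lia.
Qed.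

Lemma cover_quasilinear :
  @quasilinear_time TwoCovering Bipartite3DominatingSet cover_bipartite_graph.
Proof.
exists 1, (compile 0 cover_cmd), (70 * 100), 2 => S.
have [r4 [r6 [r7 [r8 [r9 [ms]]]]]] :=
  cover_cmd_run (set_system_sizeE S) (leqnn _) (set_lists_lt S).
move/run_computes=> [t]; rewrite -enc_set_systemE size_map -enc_cover_graph.
by move=> ct le_t; exists t => //; apply: time_quasilinear.
Qed.

Lemma cover_subset_quasilinear :
  @quasilinear_time TwoCovering BipartiteSubset2DominatingSet cover_subset_graph.
Proof.
exists 1, (compile 0 subset_cmd), (70 * 200), 2 => S.
have [ms] := subset_cmd_run (set_system_sizeE S) (leqnn _) (set_lists_lt S).
move/run_computes=> [t].
rewrite -enc_set_systemE size_map -enc_cover_graph -enc_copies_set.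
by move=> ct le_t; exists t => //; apply: time_quasilinear.
Qed.

(** Copying the first number takes two instructions on numbers at most 1, hence cost at most 10. *)
Lemma first_bit_linear (T : Type) (enc : T -> seq nat) (g : T -> bool) :
  (forall o, ohead (enc o) = Some (nat_of_bool (g o))) ->
  computable_in_O enc enc_bool (fun o => \sum_(k <- enc o) bitlen k) id g.
Proof.
move=> encP; exists (compile 0 (Block [:: Read 0; Write 0])), 10, 0 => o.
have := encP o; case: (enc o) => //= b s [->].
have := @RunBlock 1 [:: Read 0; Write 0] (nseq 0 0, nat_of_bool (g o) :: s, [::]).
by case: (g o) => /(_ _)/run_computes [//|t /= ct le_t]; exists t => // _;
  apply: leq_trans le_t _; rewrite big_cons mulnDr; apply: leq_addr.
Qed.

(** Three distinct values against two. This rules out the case of equal output types in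
    [ql_reducible]. *)
Lemma option_neq_bool (T : Type) (x y : T) : x <> y -> option T <> bool.
Proof.
move=> xy e; have pigeon : forall a b c : option T, [\/ a = b, b = c | a = c].
  by rewrite e => -[] [] []; try (exact: Or31); try (exact: Or32); exact: Or33.
by case: (pigeon None (Some x) (Some y)) => // -[].
Qed.

Lemma two_covering_reduction (I T : Type) sz ei eo (cor : I -> option T -> Prop)
    (Phi : set_system -> I) (x y : T) : x <> y ->
  @quasilinear_time TwoCovering (Problem sz ei eo cor) Phi ->
  (forall o, ohead (eo o) = Some (nat_of_bool (isSome o))) ->
  (forall S o, cor (Phi S) o -> two_covering_correct S (isSome o)) ->
  ql_reducible TwoCovering (Problem sz ei eo cor).
Proof.
move=> xy qPhi eoP corP; exists Phi; split=> // [e|_].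
  by case: (option_neq_bool xy e).
by exists isSome => //; apply: first_bit_linear.
Qed.

Theorem theorem10 :
  ql_reducible TwoCovering Bipartite3DominatingSet /\
  ql_reducible TwoCovering BipartiteSubset2DominatingSet.
Proof.
split.
- apply: (two_covering_reduction (x := (0, 0, 0)) (y := (0, 0, 1)) _
    cover_quasilinear) => //.
    by case=> [[[]]|].
  move=> S [t|] /=.
    case=> v [w [x [_ dom]]]; split=> // _.
    by apply/dominates3_two_coverable; exists v, w, x.
  by move=> nodom; split=> // /dominates3_two_coverable.
- apply: (two_covering_reduction (x := (0, 0)) (y := (0, 1)) _
    cover_subset_quasilinear) => //.
    by case=> [[]|].
  move=> S [t|] /=.
    case=> v [w [_ dom]]; split=> // _.
    by apply/dominates2_two_coverable; exists v, w.
  by move=> nodom; split=> // /dominates2_two_coverable.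
Qed.
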